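(* Let $\mathcal{D}$ be a Steiner system $S(2,3,v)$ with point set $[v]$. Then $\mathcal{D}$ is projective if and only if $|s(\mathcal{D})|=1$, i.e., if and only if its game distribution has a unique symmetric component.
   Context: $[v]=\{0,\dots,v-1\}$. An $S(2,3,v)$ is a pair $([v],\mathcal{B})$ with $\mathcal{B}\subseteq\binom{[v]}{3}$ such that every 2-subset of $[v]$ lies in exactly one block. The projective Steiner triple system of order $2^{d+1}-1$ has point set $V=\mathbb{F}_2^{d+1}\setminus\{0\}$ and blocks $\{p,q,p+q\}$ for distinct $p,q\in V$. An $S(2,3,v)$ is projective if it is isomorphic to one of these, i.e. there is a bijection of point sets mapping blocks to blocks. Welter's game $\Gamma_{v,3}$ is the digraph on $\binom{[v]}{3}$ with edges $(P,(P\setminus\{p\})\cup\{q\})$ for $q<p$, $p\in P$, $q\notin P$. Let $N^+(P)$ be the out-neighbor set of $P$. For a design $\mathcal{D}'$ with block set $\mathcal{B}'$, define $$a_i(\mathcal{D}')=\Big|\Big\{P\in\tbinom{[v]}{3}\setminus\mathcal{B}':|N^+(P)\cap\mathcal{B}'|=i\Big\}\Big|.$$ For $\pi\in\mathrm{Sym}([v])$, $\mathcal{D}^\pi=([v],\{B^\pi:B\in\mathcal{B}\})$, and $O(\mathcal{D})=\{\mathcal{D}^\pi:\pi\in\mathrm{Sym}([v])\}$. Define $$s(\mathcal{D})=\{a_0(\mathcal{D}')+a_3(\mathcal{D}'):\mathcal{D}'\in O(\mathcal{D})\}.$$ The symmetric components of the game distribution are indexed by the elements of $s(\mathcal{D})$.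 *)

(* Defs.v *)
From mathcomp Require Import all_boot all_order all_fingroup all_algebra.
From mathcomp Require Import finmap.

Set Implicit Arguments.
Unset Strict Implicit.
Unset Printing Implicit Defensive.

Definition steiner_system (t k : nat) (T : finType) (B : {set {set T}}) : Prop :=
  (forall b : {set T}, b \in B -> #|b| = k) /\
  (forall e : {set T}, #|e| = t -> #|[set b in B | e \subset b]| = 1).

Definition design_iso (T U : finType)
    (B : {set {set T}}) (C : {set {set U}}) : Prop :=
  exists2 f : T -> U, bijective f & [set f @: b | b : {set T} in B] = C.

Definition proj_point (n : nat) : finType := {x : 'rV['F_2]_n | x != 0%R}.

Definition proj_blocks (n : nat) : {set {set proj_point n}} :=
  [set b : {set proj_point n} | [exists p : proj_point n,
     exists q : proj_point n, exists r : proj_point n,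
     [&& p != q, sval r == (sval p + sval q)%R & b == [set p; q; r]]]].

(* Here n = d + 1.  The value n = 0 gives the empty system, which is only
   isomorphic to the Steiner system on the empty point set. *)
Definition projective (T : finType) (B : {set {set T}}) : Prop :=
  exists n : nat, design_iso (proj_blocks n) B.

Definition welter_edge (v k : nat) : rel {set 'I_v} := fun P Q =>
  (#|P| == k) && [exists p, exists q,
    [&& p \in P, q \notin P, q < p & Q == q |: (P :\ p)]].

Definition out_neighbors (T : finType) (e : rel T) (x : T) : {set T} :=
  [set y | e x y].

Definition num_a (v : nat) (i : nat) (B : {set {set 'I_v}}) : nat :=
  #|[set P : {set 'I_v} | [&& #|P| == 3, P \notin B &
      #|out_neighbors (@welter_edge v 3) P :&: B| == i]]|.

Definition design_orbit (v : nat) (B : {set {set 'I_v}}) :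
    {set {set {set 'I_v}}} :=
  [set [set pi @: b | b : {set 'I_v} in B] | pi : 'S_v].

Definition s_values (v : nat) (B : {set {set 'I_v}}) : {fset nat} :=
  [fset (num_a 0 B' + num_a 3 B')%N | B' in design_orbit B]%fset.

(* Main.v *)
Require Import Defs.
From mathcomp Require Import all_boot all_order all_fingroup all_algebra.
From mathcomp Require Import finmap.
From mathcomp Require Import zify.

Set Implicit Arguments.
Unset Strict Implicit.
Unset Printing Implicit Defensive.

Import GRing.Theory.

(** For a triple [{x, y, z}] that is not a block, the out-neighbours that are
    blocks correspond to the inequalities [yz < x], [xz < y], [xy < z], where
    [pq] is the third point of the block through [p] and [q]. With the signs
    [s] of the three differences, four times the indicator of "none or all hold"
    is [1] plus the sum of the pairwise products of the signs, so that [a_0 + a_3]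
    of a relabelled design is a constant plus a multiple of the sum of
    [s(x, yz) s(y, xz)] over ordered noncollinear triples.

    If Pasch's axiom [(xz)(xy) = yz] holds, the involution
    [(x, y, z) -> (x, xz, xy)] flips the sign of every term, and the sum vanishes
    for every labelling. Conversely, if the sum is the same for all labellings,
    then so is its second difference under the exchanges of the labels 0, 1 of
    [u, w] and of the labels 2, 3 of [b, d]. This difference is a nonzero multiple
    of [[wb = ud] - [ub = wd]], and its vanishing is Pasch's axiom.

    Finally, Pasch's axiom is associativity of the operation that makes the
    points with an added zero an elementary abelian 2-group. *)

(** * The third-point operation of a Steiner triple system and Pasch's axiom *)

Section ThirdPoint.

Variables (T : finType) (B : {set {set T}}).

(* The value on the diagonal is a junk value. *)
Definition third (p q : T) : T := odflt p [pick r | [set p; q; r] \in B].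

Definition noncollinear (x y z : T) : bool :=
  [&& x != y, y != z, x != z & [set x; y; z] \notin B].

Hypothesis hB : steiner_system 2 3 B.

Lemma card_block (b : {set T}) : b \in B -> #|b| = 3.
Proof. by case: hB => h _; apply: h. Qed.

Lemma card_set3 (p q r : T) :
  #|[set p; q; r]| = 3 <-> [&& p != q, q != r & p != r].
Proof.
rewrite setUC cardsU1 cards2 !inE negb_or [r == p]eq_sym [r == q]eq_sym.
by case: (p != q); case: (q != r); case: (p != r).
Qed.

Lemma eq_block (p q : T) (b c : {set T}) :
  p != q -> b \in B -> c \in B -> p \in b -> q \in b -> p \in c -> q \in c ->
  b = c.
Proof.
move=> pq bB cB pb qb pc qc; have [_ /(_ [set p; q])] := hB.
rewrite cards2 pq => /(_ erefl)/eqP/cards1P[d Ed].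
have mem_d (e : {set T}) : e \in B -> p \in e -> q \in e -> e = d.
  by move=> eB pe qe; apply/set1P; rewrite -Ed inE eB subUset !sub1set pe qe.
by rewrite (mem_d b bB pb qb) (mem_d c cB pc qc).
Qed.

Lemma third_block (p q : T) : p != q -> [set p; q; third p q] \in B.
Proof.
move=> pq; rewrite /third; case: pickP => // noB; exfalso.
have [_ /(_ [set p; q])] := hB; rewrite cards2 pq => /(_ erefl)/eqP/cards1P[d Ed].
have: d \in [set d] by rewrite inE.
rewrite -Ed inE subUset !sub1set => /andP[dB /andP[pd qd]].
have qdp : q \in d :\ p by rewrite !inE eq_sym pq.
have := card_block dB; rewrite (cardsD1 p) pd (cardsD1 q) qdp => -[] /eqP/cards1P[r Er].
by case/negP: (noB r); rewrite -setUA -Er !setD1K.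
Qed.

Lemma thirdE (p q r : T) : [set p; q; r] \in B -> third p q = r.
Proof.
move=> rB; have /card_set3/and3P[pq qr pr] := card_block rB.
have tB := third_block pq.
have Er : [set p; q; r] = [set p; q; third p q].
  by apply: (@eq_block p q) => //; rewrite !inE eqxx ?orbT.
have : r \in [set p; q; third p q] by rewrite -Er !inE eqxx !orbT.
by rewrite !inE (eq_sym r p) (eq_sym r q) (negPf pr) (negPf qr) => /eqP.
Qed.

Lemma third_block_eq (p q r : T) :
  p != q -> ([set p; q; r] \in B) = (r == third p q).
Proof.
by move=> pq; apply/idP/eqP => [/thirdE // | ->]; apply: third_block.
Qed.

Lemma third_neq (p q : T) : p != q -> (p != third p q) && (q != third p q).
Proof. by move=> /third_block/card_block/card_set3/and3P[_ -> ->]. Qed.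

Lemma set3C (p q r : T) : [set p; q; r] = [set q; p; r].
Proof. by rewrite [[set p; q]]setUC. Qed.

Lemma set3AC (p q r : T) : [set p; q; r] = [set p; r; q].
Proof. by rewrite setUAC. Qed.

Lemma thirdC (p q : T) : third p q = third q p.
Proof.
have [->//|pq] := eqVneq p q.
by apply: thirdE; rewrite set3C third_block // eq_sym.
Qed.

Lemma thirdK (p q : T) : p != q -> third p (third p q) = q.
Proof. by move=> pq; apply: thirdE; rewrite set3AC third_block. Qed.

Lemma noncollinearE (x y z : T) :
  noncollinear x y z = [&& x != y, y != z, x != z & z != third x y].
Proof.
rewrite /noncollinear; case: eqVneq => //= xy.
by rewrite third_block_eq.
Qed.

Lemma noncollinear_swap (x y z : T) : noncollinear x y z = noncollinear y x z.
Proof.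
by rewrite /noncollinear set3C eq_sym; case: (y == x); case: (y == z); case: (x == z).
Qed.

Lemma noncollinear_rot (x y z : T) : noncollinear x y z = noncollinear y z x.
Proof.
rewrite /noncollinear set3C set3AC (eq_sym z x) (eq_sym y x).
by case: (x == y); case: (y == z); case: (x == z).
Qed.

(* The axiom of Veblen, or Pasch, in the case of lines with three points. *)
Definition pasch : Prop := forall x y z : T, noncollinear x y z ->
  third (third x z) (third x y) = third y z.

End ThirdPoint.

(** * Passing from 3-subsets to their orderings *)

Section OrderedTriples.

Lemma card_orderings (T : finType) (P : {set T}) : #|P| = 3 ->
  #|[pred t : T * T * T | [&& t.1.1 != t.1.2, t.1.2 != t.2, t.1.1 != t.2
      & [set t.1.1; t.1.2; t.2] == P]]| = 6.
Proof.
move=> P3; pose A (p : T * T) := (p.1 \in P) && (p.2 \in P :\ p.1).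
(* An ordering is chosen point by point, with 3, then 2, then 1 possibilities. *)
transitivity (\sum_(p | A p) \sum_(z in P :\ p.1 :\ p.2) 1)%N.
  rewrite pair_big_dep -sum1_card; apply: eq_bigl => -[[x y] z]; rewrite inE /= /A /=.
  rewrite !inE (eq_sym y x) (eq_sym z y) (eq_sym z x).
  apply/idP/idP.
    case/and4P=> xy yz xz /eqP <-.
    by rewrite !inE !eqxx !orbT xy yz xz.
  case/andP=> /and3P[xP xy yP] /and3P[yz xz zP]; rewrite xy yz xz /=.
  rewrite eqEcard P3 !subUset !sub1set xP yP zP /=.
  by rewrite (proj2 (card_set3 x y z)) // xy yz xz.
have cardD (x : T) (Q : {set T}) n : x \in Q -> #|Q| = n.+1 -> #|Q :\ x| = n.
  by move=> xQ; rewrite (cardsD1 x) xQ => -[].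
transitivity (\sum_(p | A p) 1)%N.
  apply: eq_bigr => -[x y] /andP[/= xP yP]; rewrite sum1_card.
  by do 2?apply: (cardD).
rewrite /A -(pair_big_dep (mem P) (fun x y => y \in P :\ x) (fun _ _ => 1%N)) /=.
rewrite (eq_bigr (fun=> 2%N)) => [|x xP]; first by rewrite sum_nat_const P3.
by rewrite sum1_card; apply: (cardD).
Qed.

Local Open Scope ring_scope.

(** Each 3-subset has six orderings. Ordered triples are preferred because involutions and rotations
    of the coordinates can then act on the summation index. *)
Lemma sum_orderings (T : finType) (F : {set T} -> int) :
  \sum_(t : T * T * T | [&& t.1.1 != t.1.2, t.1.2 != t.2 & t.1.1 != t.2])
    F [set t.1.1; t.1.2; t.2] = (\sum_(P : {set T} | #|P| == 3%N) F P) *+ 6.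
Proof.
rewrite (partition_big (fun t => [set t.1.1; t.1.2; t.2])
           (fun P : {set T} => #|P| == 3%N)) /=; last first.
  by move=> t /and3P[xy yz xz]; apply/eqP/card_set3; rewrite xy yz xz.
rewrite -sumrMnl; apply: eq_bigr => P /eqP P3.
rewrite -(card_orderings P3) -sumr_const.
apply: eq_big => [t | t /andP[_ /eqP -> //]].
by rewrite !inE -!andbA.
Qed.

End OrderedTriples.

(** * Moves of Welter's game that end in a block *)

Section WelterCount.

Variables (v : nat) (B : {set {set 'I_v}}).
Hypothesis hB : steiner_system 2 3 B.

Lemma setD1_set3 (T : finType) (x y z : T) :
  x != y -> x != z -> [set x; y; z] :\ x = [set y; z].
Proof.
move=> xy xz; apply/setP=> t; rewrite !inE.
by case: eqVneq => //= ->; rewrite (negPf xy) (negPf xz).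
Qed.

Lemma out_block_edge (x y z : 'I_v) : noncollinear B x y z ->
  third B y z < x ->
  [set y; z; third B y z] \in out_neighbors (@welter_edge v 3) [set x; y; z].
Proof.
move=> nc lt; have := nc; rewrite /noncollinear => /and4P[xy yz xz nB].
rewrite inE /welter_edge (proj2 (card_set3 x y z)) ?xy ?yz ?xz //=.
apply/existsP; exists x; apply/existsP; exists (third B y z).
rewrite setD1_set3 // (setUC [set y; z]) lt eqxx !inE eqxx andbT /= !negb_or.
have /andP[y3 z3] := third_neq hB yz.
rewrite eq_sym in y3; rewrite eq_sym in z3; rewrite y3 z3 !andbT.
by apply: contraTneq lt => ->; rewrite ltnn.
Qed.

Lemma out_block_third (x y z q : 'I_v) : noncollinear B x y z ->
  q |: ([set x; y; z] :\ x) \in B -> q = third B y z.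
Proof.
rewrite /noncollinear => /and4P[xy yz xz nB].
by rewrite setD1_set3 // setUC => /(thirdE hB).
Qed.

(** A move replacing [x] keeps [y] and [z], so the only block it can reach is the one through them;
    the move is legal exactly when the third point of that block is below [x]. The other two moves
    are rotations of this one. *)
Lemma out_blocksE (x y z : 'I_v) : noncollinear B x y z ->
  out_neighbors (@welter_edge v 3) [set x; y; z] :&: B =
  (if third B y z < x then [set [set y; z; third B y z]] else set0) :|:
  ((if third B z x < y then [set [set z; x; third B z x]] else set0) :|:
   (if third B x y < z then [set [set x; y; third B x y]] else set0)).
Proof.
move=> nc; have nc' := nc; have nc'' := nc.
rewrite noncollinear_rot in nc'; rewrite 2!noncollinear_rot in nc''.
have E1 : [set y; z; x] = [set x; y; z] by rewrite set3AC set3C.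
have E2 : [set z; x; y] = [set x; y; z] by rewrite set3C set3AC.
have := nc; rewrite /noncollinear => /and4P[xy yz xz nB].
apply/setP=> Q; rewrite in_setI in_setU in_setU; apply/idP/idP.
  case/andP; rewrite inE => /andP[_ /existsP[p /existsP[q]]].
  case/and4P=> pP qP qp /eqP -> QB.
  move: pP qp QB; rewrite !inE -orbA => /or3P[]/eqP-> lt QB.
  - have eq := out_block_third nc QB.
    by rewrite -eq lt setD1_set3 // setUC inE eqxx.
  - have := QB; rewrite -E1 => /(out_block_third nc') eq.
    by rewrite -eq lt setD1_set3 // 1?eq_sym // [q |: _]setUC inE eqxx orbT.
  - have := QB; rewrite -E2 => /(out_block_third nc'') eq.
    by rewrite -eq lt setD1_set3 // 1?eq_sym // [q |: _]setUC inE eqxx !orbT.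
case/or3P; case: ifP => lt; rewrite !inE // => /eqP->.
- by have := out_block_edge nc lt; rewrite inE => ->; rewrite third_block.
- by have := out_block_edge nc' lt; rewrite E1 inE => ->; rewrite third_block // eq_sym.
- by have := out_block_edge nc'' lt; rewrite E2 inE => ->; rewrite third_block.
Qed.

(** A common block would contain [x], [y] and [z], which are not collinear. Hence the reachable
    blocks are distinct and their indicators add up. *)
Lemma set3_third_neq (x y z : 'I_v) : noncollinear B x y z ->
  [set y; z; third B y z] != [set z; x; third B z x].
Proof.
rewrite /noncollinear => /and4P[xy yz xz nB]; apply: contraNneq nB => E.
rewrite set3C set3AC third_block_eq //.
have : x \in [set z; x; third B z x] by rewrite !inE eqxx !orbT.
by rewrite -E !inE (negPf xy) (negPf xz).
Qed.

Lemma card_out_blocks (x y z : 'I_v) : noncollinear B x y z ->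
  #|out_neighbors (@welter_edge v 3) [set x; y; z] :&: B| =
  (third B y z < x) + (third B z x < y) + (third B x y < z).
Proof.
move=> nc; rewrite (out_blocksE nc).
have n1 := set3_third_neq nc; rewrite noncollinear_rot in nc.
have n2 := set3_third_neq nc; rewrite noncollinear_rot in nc.
have n3 := set3_third_neq nc; rewrite eq_sym in n3.
case: ifP => _; case: ifP => _; case: ifP => _;
  by rewrite ?setU0 ?set0U ?cards0 ?cards1 ?cards2 ?n1 ?n2 ?n3 // cardsU1 cards2
     !inE negb_or n1 n2 n3.
Qed.

End WelterCount.

(** * The bilinear form behind the number of symmetric triples *)

Section QuadraticForm.

Local Open Scope ring_scope.

Definition sign_of (b : bool) : int := if b then 1 else -1.

Section Bilinear.

Variables (T : finType) (B : {set {set T}}).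

(** Allowing two arbitrary kernels instead of one order sign makes the sum bilinear, so that a
    change of labelling can be expanded; exchanging [x] and [y] shows that it is symmetric. *)
Definition third_form (f g : T -> T -> int) : int :=
  \sum_(t : T * T * T | noncollinear B t.1.1 t.1.2 t.2)
    f t.1.1 (third B t.1.2 t.2) * g t.1.2 (third B t.1.1 t.2).

Hypothesis hB : steiner_system 2 3 B.

Lemma sum_swap (F : T -> T -> T -> int) :
  \sum_(t : T * T * T | noncollinear B t.1.1 t.1.2 t.2) F t.1.1 t.1.2 t.2 =
  \sum_(t : T * T * T | noncollinear B t.1.1 t.1.2 t.2) F t.1.2 t.1.1 t.2.
Proof.
rewrite (reindex (fun t : T * T * T => (t.1.2, t.1.1, t.2))) /=; last first.
  by exists (fun t => (t.1.2, t.1.1, t.2)) => -[[]].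
by apply: eq_bigl => t; rewrite -noncollinear_swap.
Qed.

Lemma sum_rot (F : T -> T -> T -> int) :
  \sum_(t : T * T * T | noncollinear B t.1.1 t.1.2 t.2) F t.1.1 t.1.2 t.2 =
  \sum_(t : T * T * T | noncollinear B t.1.1 t.1.2 t.2) F t.1.2 t.2 t.1.1.
Proof.
rewrite (reindex (fun t : T * T * T => (t.1.2, t.2, t.1.1))) /=; last first.
  by exists (fun t => (t.2, t.1.1, t.1.2)) => -[[]].
by apply: eq_bigl => t; rewrite -noncollinear_rot.
Qed.

Lemma third_formC (f g : T -> T -> int) : third_form f g = third_form g f.
Proof.
rewrite /third_form (sum_swap (fun x y z => f x (third B y z) * g y (third B x z))).
by apply: eq_bigr => t _; rewrite mulrC.
Qed.

Lemma third_formDl (f1 f2 g : T -> T -> int) :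
  third_form (fun x y => f1 x y + f2 x y) g = third_form f1 g + third_form f2 g.
Proof. by rewrite /third_form -big_split; apply: eq_bigr => t _; rewrite mulrDl. Qed.

Lemma third_formNl (f g : T -> T -> int) : third_form (fun x y => - f x y) g = - third_form f g.
Proof. by rewrite /third_form -sumrN; apply: eq_bigr => t _; rewrite mulNr. Qed.

Lemma third_formDr (f g1 g2 : T -> T -> int) :
  third_form f (fun x y => g1 x y + g2 x y) = third_form f g1 + third_form f g2.
Proof. by rewrite third_formC third_formDl ![third_form _ f]third_formC. Qed.

Lemma third_formNr (f g : T -> T -> int) : third_form f (fun x y => - g x y) = - third_form f g.
Proof. by rewrite third_formC third_formNl third_formC. Qed.

Lemma eq_third_form (f1 f2 g1 g2 : T -> T -> int) :
  f1 =2 f2 -> g1 =2 g2 -> third_form f1 g1 = third_form f2 g2.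
Proof. by move=> Ef Eg; apply: eq_bigr => t _; rewrite Ef Eg. Qed.

(** Polarization leaves only the mixed terms. The factor 8 is 4 from the two doubled increments
    times 2 from the symmetry of the form; increments are doubled since a sign changes by 2 or
    -2. *)
Lemma third_form_second_difference (s f g : T -> T -> int) :
  let q h := third_form h h in
  q (fun x y => s x y + (f x y + f x y) + (g x y + g x y)) =
  q (fun x y => s x y + (f x y + f x y)) + q (fun x y => s x y + (g x y + g x y))
    - q s + third_form g f *+ 8.
Proof. by rewrite /= !(third_formDl, third_formDr) (third_formC f g); lia. Qed.

(* The involution (x, y, z) -> (x, xz, xy) swaps the arguments of the second
   factor and fixes the first one. *)
Lemma third_form_pasch (f g : T -> T -> int) : pasch B ->
  (forall x y, x != y -> g y x = - g x y) -> third_form f g = 0.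
Proof.
move=> hP gN; suff : third_form f g = - third_form f g by lia.
pose h (t : T * T * T) := (t.1.1, third B t.1.1 t.2, third B t.1.1 t.1.2).
have hK (t : T * T * T) : noncollinear B t.1.1 t.1.2 t.2 -> h (h t) = t.
  rewrite /noncollinear => /and4P[xy yz xz _].
  by rewrite /h /= !thirdK //; case: t xy yz xz => -[].
have nch (t : T * T * T) : noncollinear B t.1.1 t.1.2 t.2 ->
    noncollinear B (h t).1.1 (h t).1.2 (h t).2.
  move=> nc; have := hP _ _ _ nc; move: nc.
  case: t => -[x y] z; rewrite /h /= => /and4P[xy yz xz nB] E.
  have /andP[n1 n1'] := third_neq hB xy; have /andP[n2 n2'] := third_neq hB xz.
  rewrite noncollinearE // n1 n2 thirdK //=; apply/andP; split.
    by apply: contra_neq yz => E'; rewrite -(thirdK hB xy) -(thirdK hB xz) E'.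
  by apply: contraNneq nB => <-; rewrite third_block.
(* Reindexing by the involution [h] exhibits the sum as its own opposite. *)
rewrite {1}/third_form (reindex_onto h h) => [|t]; last exact: hK.
rewrite /third_form -sumrN; apply: eq_big => [t | t].
  apply/andP/idP => [[nc /eqP <-] | nc]; first exact: nch.
  by rewrite nch // hK.
case/andP=> nc' /eqP Eh; have := nch _ nc'; rewrite Eh => nc.
have := nc; case: t nc {nc' Eh} => -[x y] z; rewrite /h /= => nc.
rewrite /noncollinear => /and4P[xy yz xz nB].
rewrite (hP _ _ _ nc) (thirdK hB xy) (gN y) ?mulrN //.
(* Skewness of [g] needs distinct arguments: [y] is not the third point of [x] and [z], since the
   triple is not a block. *)
by apply: contraNneq nB => ->; rewrite set3C set3AC set3C thirdC //
  set3AC third_block // eq_sym.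
Qed.

End Bilinear.

(* The factor 24 counts 6 orderings of each triple and the factor 4 of
   [4 * [all signs equal] = 1 + s1 s2 + s2 s3 + s1 s3]. *)
Lemma num_a_third_form (v : nat) (B : {set {set 'I_v}}) : steiner_system 2 3 B ->
  let s (x y : 'I_v) := sign_of (y < x)%N in
  ((num_a 0 B + num_a 3 B) * 24)%N%:Z =
  #|[pred t : 'I_v * 'I_v * 'I_v | noncollinear B t.1.1 t.1.2 t.2]|%:Z
    + third_form B s s *+ 3.
Proof.
move=> hB s; pose out P := #|out_neighbors (@welter_edge v 3) P :&: B|.
pose F P : int := ((P \notin B) && ((out P == 0%N) || (out P == 3%N)))%:Z.
have Enum : (num_a 0 B + num_a 3 B)%N%:Z = \sum_(P : {set 'I_v} | #|P| == 3%N) F P.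
  have cardE (A : pred {set 'I_v}) : #|A|%:Z = \sum_P (P \in A)%:Z.
    by rewrite -sum1_card big_mkcond (big_morph Posz PoszD (erefl _));
      apply: eq_bigr => P _; case: ifP.
  rewrite /num_a PoszD !cardE -big_split [RHS]big_mkcond /=; apply: eq_bigr => P _.
  rewrite !inE /F /out; case: (#|P| == 3%N) => //=; case: (P \notin B) => //=.
  by case: eqP => [->|] //=; case: eqP.
have Enc : (num_a 0 B + num_a 3 B)%N%:Z *+ 6 =
    \sum_(t : 'I_v * 'I_v * 'I_v | noncollinear B t.1.1 t.1.2 t.2)
      F [set t.1.1; t.1.2; t.2].
  rewrite Enum -sum_orderings [LHS]big_mkcond [RHS]big_mkcond.
  apply: eq_bigr => t _; rewrite /noncollinear /F.
  by case: (t.1.1 != t.1.2); case: (t.1.2 != t.2); case: (t.1.1 != t.2);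
    case: (_ \notin B).
pose b x y z := s x (third B y z) * s y (third B x z).
have E4 (t : 'I_v * 'I_v * 'I_v) : noncollinear B t.1.1 t.1.2 t.2 ->
    F [set t.1.1; t.1.2; t.2] *+ 4 =
    1 + (b t.1.1 t.1.2 t.2 + (b t.1.2 t.2 t.1.1 + b t.2 t.1.1 t.1.2)).
  case: t => -[x y] z /= nc; have := nc; rewrite /noncollinear => /and4P[_ _ _ nB].
  rewrite /F /out nB card_out_blocks // /b /s.
  rewrite (thirdC hB x z) (thirdC hB y x) (thirdC hB z y).
  by case: (third B y z < x)%N; case: (third B z x < y)%N; case: (third B x y < z)%N.
rewrite PoszM (_ : _ * 24%:Z = (num_a 0 B + num_a 3 B)%N%:Z *+ 6 *+ 4); last by lia.
rewrite Enc -sumrMnl (eq_bigr _ E4) !big_split /= sumr_const.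
(* Rotating the triple identifies the sums of the three products of signs, whence the factor 3. *)
rewrite -(sum_rot B (fun x y z => b y z x)) -(sum_rot B b).
by rewrite natz /third_form /b -mulr2n -mulrS; congr (Posz _ + _); apply: eq_card.
Qed.


(** * Relabelling the points by a permutation *)

Lemma imset3 (T U : finType) (f : T -> U) (x y z : T) :
  f @: [set x; y; z] = [set f x; f y; f z].
Proof. by rewrite !imsetU !imset_set1. Qed.

(** The order of the new labels is pulled back to the old points: the design stays fixed and only
    the kernel of the form depends on the labelling. *)
Definition perm_sign (v : nat) (pi : 'S_v) (x y : 'I_v) : int :=
  sign_of (pi y < pi x)%N.

Section Relabelling.

Variables (v : nat) (B : {set {set 'I_v}}) (pi : 'S_v).
Hypothesis hB : steiner_system 2 3 B.

Let piB : {set {set 'I_v}} := [set pi @: b | b : {set 'I_v} in B].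

Lemma perm_set_mem (b : {set 'I_v}) : (pi @: b \in piB) = (b \in B).
Proof. by rewrite mem_imset //; apply: imset_inj; apply: perm_inj. Qed.

Lemma perm_steiner : steiner_system 2 3 piB.
Proof.
case: hB => h1 h2; split=> [_ /imsetP[b bB ->] | e e2].
  by rewrite card_imset ?h1 //; apply: perm_inj.
have Ee : e = pi @: (pi^-1%g @: e).
  by rewrite -imset_comp -[LHS]imset_id; apply: eq_imset => x /=; rewrite permKV.
rewrite -(h2 (pi^-1%g @: e)); last by rewrite card_imset ?e2 //; apply: perm_inj.
rewrite -[RHS](card_imset _ (imset_inj (@perm_inj _ pi))); apply: eq_card => c.
have Hsub (b : {set 'I_v}) : (e \subset pi @: b) = (pi^-1%g @: e \subset b).
  apply/idP/idP => [/(imsetS pi^-1%g) | /(imsetS pi)]; last by rewrite -Ee.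
  rewrite -imset_comp (_ : _ @: b = b) // -[RHS]imset_id.
  by apply: eq_imset => x /=; rewrite permK.
rewrite inE; apply/andP/imsetP => [[/imsetP[b bB ->]] | [b]].
  by rewrite Hsub => eb; exists b; rewrite ?inE ?bB.
by rewrite inE => /andP[bB eb] ->; rewrite Hsub imset_f.
Qed.

Lemma perm_noncollinear (x y z : 'I_v) :
  noncollinear piB (pi x) (pi y) (pi z) = noncollinear B x y z.
Proof. by rewrite /noncollinear !(inj_eq perm_inj) -imset3 perm_set_mem. Qed.

Lemma perm_third (x y : 'I_v) : x != y ->
  third piB (pi x) (pi y) = pi (third B x y).
Proof.
move=> xy; apply: (thirdE perm_steiner).
by rewrite -imset3 perm_set_mem third_block.
Qed.

(** Reindexing triples by [pi] moves the relabelling from the design into the kernel, and the first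
    summand no longer depends on [pi]. *)
Lemma num_a_perm :
  ((num_a 0 piB + num_a 3 piB) * 24)%N%:Z =
  #|[pred t : 'I_v * 'I_v * 'I_v | noncollinear B t.1.1 t.1.2 t.2]|%:Z
    + third_form B (perm_sign pi) (perm_sign pi) *+ 3.
Proof.
rewrite (num_a_third_form perm_steiner).
pose h (t : 'I_v * 'I_v * 'I_v) := (pi t.1.1, pi t.1.2, pi t.2).
have h_bij : bijective h.
  exists (fun t => (pi^-1%g t.1.1, pi^-1%g t.1.2, pi^-1%g t.2)) => -[[x y] z];
    by rewrite /h /= ?permK ?permKV.
congr (Posz _ + _ *+ 3).
  rewrite -!sum1_card (reindex h) /=; last exact: onW_bij.
  by apply: eq_bigl => t; rewrite !inE /= perm_noncollinear.
rewrite /third_form (reindex h) /=; last exact: onW_bij.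
apply: eq_big => [t | t]; first exact: perm_noncollinear.
rewrite perm_noncollinear /noncollinear => /and4P[xy yz xz _].
by rewrite !perm_third.
Qed.

End Relabelling.

End QuadraticForm.

(** * Constancy over all labellings implies Pasch's axiom *)

Lemma perm_index (v : nat) (s : seq 'I_v) : uniq s ->
  exists pi : 'S_v, forall x, x \in s -> pi x = index x s :> nat.
Proof.
(* The label of a point is its position in the list that begins with [s] and continues with all
   other points. *)
move=> us; pose l := s ++ [seq x <- enum 'I_v | x \notin s].
have ml x : x \in l by rewrite mem_cat mem_filter mem_enum andbT orbN.
have ul : uniq l.
  rewrite cat_uniq us filter_uniq ?enum_uniq // andbT /=.
  by apply/hasPn => x; rewrite mem_filter => /andP[].
have sl : size l = v by rewrite -(card_uniqP ul) (eq_card ml) card_ord.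
have lt x : index x l < v by rewrite -[ltnRHS]sl index_mem.
have inj : injective (fun x => Ordinal (lt x)).
  by move=> x y [] /(congr1 (nth x l)); rewrite !nth_index.
by exists (perm inj) => x xs; rewrite permE /= index_cat xs.
Qed.

Section SecondDifference.

Local Open Scope ring_scope.

Variables (v : nat) (B : {set {set 'I_v}}).
Hypothesis hB : steiner_system 2 3 B.

(** The elementary skew matrix of the pair [u], [w]: half the change of the order sign when [u] and
    [w] exchange consecutive labels. *)
Definition skew (T : eqType) (u w x y : T) : int :=
  ((x == u) && (y == w))%:Z - ((x == w) && (y == u))%:Z.

(** No label lies strictly between two consecutive ones, so the exchange affects only the comparison
    of [u] with [w]. *)
Lemma perm_sign_tperm (pi : 'S_v) (u w : 'I_v) : pi w = (pi u).+1 :> nat ->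
  forall x y, perm_sign (tperm u w * pi)%g x y =
    perm_sign pi x y + (skew u w x y + skew u w x y).
Proof.
move=> adj x y.
have uw : u != w by apply/eqP => E; move: adj; rewrite E; lia.
have val_neq a b : a != b -> (pi a : nat) <> pi b.
  by move=> ab /val_inj/perm_inj E; rewrite E eqxx in ab.
have lt1 : (pi u < (pi u).+1)%N = true by lia.
have lt2 : ((pi u).+1 < pi u)%N = false by lia.
rewrite /perm_sign /skew !permM.
case: tpermP => [->|->|/eqP yu /eqP yw]; case: tpermP => [->|->|/eqP xu /eqP xw];
  rewrite ?eqxx ?(negPf uw) ?[w == u]eq_sym ?(negPf uw) ?(negPf xu) ?(negPf xw)
    ?(negPf yu) ?(negPf yw) ?andbF ?ltnn //= ?adj ?subrr ?addr0.
- by rewrite lt1 lt2.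
- by congr sign_of; have := val_neq _ _ xu; have := val_neq _ _ xw; rewrite adj; lia.
- by rewrite lt1 lt2.
- by congr sign_of; have := val_neq _ _ xu; have := val_neq _ _ xw; rewrite adj; lia.
- by congr sign_of; have := val_neq _ _ yu; have := val_neq _ _ yw; rewrite adj; lia.
- by congr sign_of; have := val_neq _ _ yu; have := val_neq _ _ yw; rewrite adj; lia.
- by [].
Qed.

(** A nonzero term forces [x = u], [y = b] and [z = third B w b], and the remaining condition says
    that [z] is also [third B u d]. So at most one triple contributes. *)
Lemma third_form_indicator (u w b d : 'I_v) :
  u != w -> u != b -> u != d -> w != b -> b != d ->
  third_form B (fun x y => ((x == u) && (y == w))%:Z) (fun x y => ((x == b) && (y == d))%:Z)
  = (third B w b == third B u d)%:Z.
Proof.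
move=> uw ub ud wb bd; rewrite /third_form big_mkcond (bigD1 (u, b, third B w b)) //=.
rewrite big1 => [|[[x y] z] /= ne]; last first.
  case: ifP => // /and4P[xy yz xz nB].
  case: eqP => //= xu; case: eqP => //= yzw; case: eqP => //= yb; case: eqP => //= xzd.
  case/eqP: ne; rewrite -xu -yb -yzw [third B (third B y z) y](thirdC hB).
  by rewrite thirdK.
have nbt : b != third B w b by case/andP: (third_neq hB wb).
rewrite !eqxx /= addr0 (thirdC hB w b) thirdK 1?eq_sym // eqxx mul1r.
rewrite noncollinearE // ub (thirdC hB b w) nbt /=.
case: (eqVneq (third B w b) (third B u d)) => [E | ne].
  rewrite E thirdK // eqxx; case/andP: (third_neq hB ud) => -> _ /=.
  rewrite (_ : _ != _) //; apply: contra_neq bd => E'.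
  by rewrite -(thirdK hB ub) -E' thirdK.
case: ifP => // /andP[n1 n2]; case: eqP => // E.
by move: ne; rewrite E thirdK ?eqxx.
Qed.

(** Bilinearity gives four indicators; reversing both pairs at once yields the same condition, so
    they agree two by two. *)
Lemma third_form_skew (u w b d : 'I_v) : uniq [:: u; w; b; d] ->
  third_form B (skew u w) (skew b d) =
  ((third B w b == third B u d)%:Z - (third B u b == third B w d)%:Z) *+ 2.
Proof.
rewrite /= !inE !negb_or !andbT => /and3P[/and3P[uw ub ud] /andP[wb wd] bd].
pose i (x y x' y' : 'I_v) : int := ((x' == x) && (y' == y))%:Z.
have E (x y : 'I_v) : skew x y =2 (fun x' y' => i x y x' y' + - i y x x' y') by [].
rewrite (eq_third_form B (E u w) (E b d)) !(third_formDl, third_formNl, third_formDr, third_formNr).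
rewrite !third_form_indicator // 1?eq_sym // ?(eq_sym d) //; try by rewrite eq_sym.
rewrite ![third B w d == _]eq_sym ![third B u d == _]eq_sym.
lia.
Qed.

Lemma pasch_of_const :
  (forall pi, third_form B (perm_sign pi) (perm_sign pi) =
              third_form B (perm_sign 1%g) (perm_sign 1%g)) -> pasch B.
Proof.
move=> hc.
have key (u w b d : 'I_v) : uniq [:: u; w; b; d] ->
    third B w b = third B u d -> third B u b = third B w d.
  (* Labels 0, 1, 2, 3 on [u], [w], [b], [d] make both pairs consecutive. *)
  move=> us E; have [pi Hpi] := perm_index us.
  have pu : pi u = 0%N :> nat by rewrite Hpi ?inE ?eqxx //= eqxx.
  have := us; rewrite /= !inE !negb_or !andbT => /and3P[/and3P[uw ub ud] /andP[wb wd] bd].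
  have pw : pi w = 1%N :> nat by rewrite Hpi ?inE ?eqxx ?orbT //= (negPf uw) eqxx.
  have pb : pi b = 2%N :> nat.
    by rewrite Hpi ?inE ?eqxx ?orbT //= (negPf ub) (negPf wb) eqxx.
  have pd : pi d = 3%N :> nat.
    by rewrite Hpi ?inE ?eqxx ?orbT //= (negPf ud) (negPf wd) (negPf bd) eqxx.
  have Suw : forall x y, _ := @perm_sign_tperm pi u w (etrans pw (congr1 S (esym pu))).
  have Sbd : forall x y, _ := @perm_sign_tperm pi b d (etrans pd (congr1 S (esym pb))).
  (* The two pairs are disjoint, so after exchanging [b] and [d] the labels of [u] and [w] are still
     consecutive. *)
  have adj : (tperm b d * pi)%g w = ((tperm b d * pi)%g u).+1 :> nat.
    by rewrite !permM !tpermD ?pw ?pu // eq_sym.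
  have Sall x y : perm_sign (tperm u w * (tperm b d * pi))%g x y =
      perm_sign pi x y + (skew b d x y + skew b d x y)
        + (skew u w x y + skew u w x y).
    by rewrite (perm_sign_tperm adj) Sbd.
  have := third_form_second_difference B (perm_sign pi) (skew b d) (skew u w).
  rewrite /= -(eq_third_form B Sall Sall) -(eq_third_form B Suw Suw) -(eq_third_form B Sbd Sbd).
  (* All four labellings give the same value, so the mixed term must vanish. *)
  rewrite !(hc pi, hc (_ * _)%g) third_form_skew //.
  rewrite E eqxx; case: eqP => //= _; lia.
move=> x y z nc; have := nc; rewrite noncollinearE // => /and4P[xy yz xz zxy].
have /andP[n1 n1'] := third_neq hB xy; have /andP[n2 n2'] := third_neq hB xz.
have n3 : y != third B x z.
  by apply: contra_neq zxy => ->; rewrite thirdK.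
have n4 : third B x z != third B x y.
  by apply: contra_neq yz => E; rewrite -(thirdK hB xz) E thirdK.
(* Here [u] is [third B x z], [w] is [y], [b] is [third B x y] and [d] is [z]; both sides of the
   premise of [key] equal [x]. *)
apply: key; first by 
  rewrite /= !inE !negb_or n4 n1' yz (eq_sym _ y) n3 (eq_sym _ z) n2'
    (eq_sym _ z) zxy.
rewrite (thirdC hB x y) thirdC // (thirdC hB (third B y x)) (thirdK hB) 1?eq_sym //.
by rewrite (thirdC hB x z) (thirdC hB _ z) thirdK // eq_sym.
Qed.

End SecondDifference.

(** * Finite elementary abelian 2-groups as spaces of row vectors *)

Section ElementaryAbelian.

Variables (U : finType) (o : U) (add : U -> U -> U).
Hypotheses (addA : associative add) (addC : commutative add).
Hypotheses (add0 : left_id o add) (addxx : forall x, add x x = o).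

(** An injective additive map is extended by one dimension at a time, sending the new basis vector
    to an element outside the image, until it is onto. *)
Lemma elementary_abelian_iso : exists n (h : 'rV['F_2]_n -> U),
  bijective h /\ forall a b, h (a + b)%R = add (h a) (h b).
Proof.
have addACA a b c d : add (add a b) (add c d) = add (add a c) (add b d).
  by rewrite !addA -(addA a b c) (addC b c) addA.
have card2 n : #|{: 'rV['F_2]_n}| = 2 ^ n by rewrite card_mx card_Fp // mul1n.
(* Induction on a bound [k] for the number of elements still missed, starting from dimension 0. *)
suff grow k n (h : 'rV['F_2]_n -> U) : injective h ->
    (forall a b, h (a + b)%R = add (h a) (h b)) -> #|U| <= 2 ^ n + k ->
    exists n (h : 'rV['F_2]_n -> U),
      bijective h /\ forall a b, h (a + b)%R = add (h a) (h b).
  apply: (grow #|U| 0 (fun=> o)) => [a b _ | a b |]; last exact: leq_addl.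
    by apply/rowP => -[].
  by rewrite add0.
elim: k n h => [|k IH] n h h_inj hD le.
  by exists n, h; split=> //; apply: inj_card_bij; rewrite ?card2 // -[leqRHS]addn0.
have [onto | ] := boolP [forall c, c \in codom h].
  exists n, h; split=> //; apply: inj_card_bij => //.
  apply: leq_trans (leq_image_card h _); apply: subset_leq_card.
  by apply/subsetP => c _; apply: (forallP onto).
case/forallPn=> c /negP nc.
(* The new coordinate contributes [c] or nothing; this is additive because [c] is its own
   inverse. *)
pose lead (x : 'F_2) := if x == 0%R then o else c.
have leadD x y : lead (x + y)%R = add (lead x) (lead y).
  case: x y => [[|[|[]]] // ltx] [[|[|[]]] // lty]; rewrite /lead /= ?add0 ?addxx //.
  by rewrite addC add0.
pose h' (x : 'rV['F_2]_(1 + n)) := add (lead (x ord0 ord0)) (h (rsubmx x)).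
apply: (IH _ h') => [x y | x y |].
- rewrite /h' => E.
  have Ey : lead (y ord0 ord0) =
      add (add (lead (x ord0 ord0)) (h (rsubmx x))) (h (rsubmx y)).
    by rewrite E -addA addxx addC add0.
  have : lead (x ord0 ord0 + y ord0 ord0)%R = h (rsubmx x + rsubmx y)%R.
    by rewrite leadD hD Ey !addA addxx add0.
  (* If the new coordinates differed, [c] would lie in the image of [h]. *)
  rewrite {1}/lead; case: eqP => [xy0 | _ Ec]; last by case: nc; rewrite Ec codom_f.
  rewrite hD => E0; have Er : rsubmx x = rsubmx y.
    by apply: h_inj; rewrite -[RHS]add0 E0 -addA addxx addC add0.
  have El : x ord0 ord0 = y ord0 ord0.
    move: (x ord0 ord0) (y ord0 ord0) xy0.
    by move=> [[|[|[]]] // ?] [[|[|[]]] // ?] // _; apply: val_inj.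
  rewrite -[x]hsubmxK -[y]hsubmxK Er; congr row_mx.
  apply/rowP => i; rewrite !mxE ord1.
  by have -> : lshift n (ord0 : 'I_1) = ord0 by apply: val_inj.
- have Er : (rsubmx (x + y) = rsubmx x + rsubmx y)%R.
    by apply/rowP => i; rewrite !mxE.
  by rewrite /h' mxE leadD Er hD [LHS]addACA.
(* The image doubles, hence grows by at least one, which pays for the decrease of [k]. *)
- by rewrite expnD expn1; apply: leq_trans le _; have := expn_gt0 2 n; lia.
Qed.

End ElementaryAbelian.

(** * Projective systems are those satisfying Pasch's axiom *)

Section Projective.

Variables (T : finType) (B : {set {set T}}).
Hypothesis hB : steiner_system 2 3 B.

(** In coordinates the third point is the sum, and Pasch's axiom reads [(p + r) + (p + q) = q + r],
    true in characteristic 2. *)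
Lemma pasch_of_projective : projective B -> pasch B.
Proof.
case=> n [f f_bij EB].
have f_inj := bij_inj f_bij.
have thirdD (p q : proj_point n) : p != q ->
    exists r, val r = (val p + val q)%R /\ third B (f p) (f q) = f r.
  move=> pq; have nz : (val p + val q != 0)%R.
    apply: contra_neq pq => E; apply: val_inj; apply/rowP => i.
    have := congr1 (fun M : 'rV_n => M ord0 i) E; rewrite !mxE.
    move: (val p ord0 i) (val q ord0 i).
    by move=> [[|[|[]]] // ?] [[|[|[]]] // ?] // _; apply: val_inj.
  exists (Sub (val p + val q)%R nz); rewrite SubK; split=> //.
  apply: (thirdE hB); rewrite -EB -imset3 imset_f // inE.
  apply/existsP; exists p; apply/existsP; exists q; apply/existsP.
  by exists (Sub (val p + val q)%R nz); rewrite pq SubK !eqxx.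
move=> x y z nc; have := nc; rewrite noncollinearE // => /and4P[].
have [g fK gK] := f_bij; rewrite -(gK x) -(gK y) -(gK z).
move: (g x) (g y) (g z) => p q r; rewrite !(inj_eq f_inj) => pq qr pr _.
have [a [Ea ->]] := thirdD _ _ pr; have [b [Eb ->]] := thirdD _ _ pq.
have [c [Ec ->]] := thirdD _ _ qr.
have ab : a != b.
  by apply: contra_neq qr => E; apply/val_inj/(addrI (val p)); rewrite -Ea -Eb E.
have [d [Ed ->]] := thirdD _ _ ab; congr f; apply: val_inj.
rewrite Ed Ea Eb Ec addrACA [(val r + _)%R]addrC -[RHS]add0r; congr (_ + _)%R.
apply/rowP => i; rewrite !mxE; move: (val p ord0 i).
by move=> [[|[|[]]] // ?]; apply: val_inj.
Qed.

(** [None] is the added zero, and every point is its own inverse. *)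
Definition point_add (x y : option T) : option T :=
  match x, y with
  | None, _ => y
  | _, None => x
  | Some p, Some q => if p == q then None else Some (third B p q)
  end.

Lemma point_addC : commutative point_add.
Proof. by case=> [p|] [q|] //=; rewrite eq_sym thirdC. Qed.

Lemma point_addK (p q : T) :
  point_add (Some p) (point_add (Some p) (Some q)) = Some q.
Proof.
rewrite /=; case: eqVneq => [-> // | pq] /=.
by have /andP[/negPf -> _] := third_neq hB pq; rewrite thirdK.
Qed.

(** Sums with zero, equal points or collinear points are settled by the axioms of a Steiner system;
    only the generic case uses Pasch. *)
Lemma point_addA : pasch B -> associative point_add.
Proof.
move=> hP [p|] [q|] [r|] //; last by rewrite /=; case: ifP.
have [<- | pq] := eqVneq p q; first by rewrite point_addK /= eqxx.
have [<- | qr] := eqVneq q r.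
  transitivity (Some p); first by rewrite /= eqxx.
  by rewrite point_addC [point_add (Some p) _]point_addC point_addK.
have [<- | pr] := eqVneq p r.
  by rewrite [RHS]point_addC [point_add (Some q) _]point_addC.
have [E | rpq] := eqVneq r (third B p q).
  rewrite E; have /andP[n1 n2] := third_neq hB pq.
  rewrite /= (negPf pq) (negPf n2) /= (thirdC hB p q) thirdK 1?eq_sym //.
  by rewrite !eqxx.
have /andP[n1 n2] := third_neq hB pq.
(* Pasch at [q] for this triple gives [(qr)(q(pq)) = (pq)r], and [q(pq)] is [p]. *)
have nc : noncollinear B q (third B p q) r.
  by rewrite noncollinearE // n2 qr (eq_sym _ r) rpq (thirdC hB p q)
    thirdK ?pr // eq_sym.
rewrite /= (negPf pq) (negPf qr) /=.
have -> : (p == third B q r) = false.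
  apply/negbTE; apply: contra_neq rpq => ->.
  by rewrite (thirdC hB _ q) thirdK.
rewrite eq_sym (negPf rpq); congr Some.
by rewrite -(hP _ _ _ nc) (thirdC hB p q) (thirdK hB) 1?eq_sym // thirdC.
Qed.

(** The group isomorphism matches the zero vector with [None], so it restricts to a bijection from
    nonzero vectors to points that turns sums into third points. *)
Lemma projective_of_pasch : pasch B -> projective B.
Proof.
move=> hP; have addxx x : point_add x x = None by case: x => //= p; rewrite eqxx.
have add0 : left_id None point_add by [].
have [n [h [h_bij hD]]] := elementary_abelian_iso (point_addA hP) point_addC add0 addxx.
have [g hK gK] := h_bij; have h_inj := bij_inj h_bij.
have h0 : h 0%R = None by rewrite -(addxx (h 0%R)) -hD addr0.
have hS (p : proj_point n) : exists t, h (val p) == Some t.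
  case E : (h (val p)) => [t|]; first by exists t.
  by case/eqP: (valP p); apply: h_inj; rewrite h0.
pose f p := xchoose (hS p).
have hf p : h (val p) = Some (f p) by apply/eqP/(xchooseP (hS p)).
have nz t : (g (Some t) != 0)%R by apply/eqP => E; have := gK (Some t); rewrite E h0.
pose g' t : proj_point n := Sub (g (Some t)) (nz t).
have fK : cancel f g' by move=> p; apply: val_inj; rewrite /= -hf hK.
have gK' : cancel g' f by move=> t; apply: Some_inj; rewrite -hf gK.
have f_inj := can_inj fK.
exists n, f; first by exists g'.
apply/setP => b; apply/imsetP/idP => [[c] | bB].
  rewrite inE => /existsP[p /existsP[q /existsP[r /and3P[pq /eqP Er /eqP ->]]]] ->.
  rewrite imset3; have := hf r.
  rewrite [val r]Er hD !hf /= (inj_eq f_inj) (negPf pq) => -[<-].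
  by rewrite third_block // (inj_eq f_inj).
have /card_gt0P[x xb] : 0 < #|b| by rewrite (card_block hB bB).
have /card_gt0P[y] : 0 < #|b :\ x|.
  by have := card_block hB bB; rewrite (cardsD1 x) xb; lia.
rewrite !inE => /andP[yx yb]; rewrite eq_sym in yx.
have Eb : [set x; y; third B x y] = b.
  by apply: (eq_block hB yx); rewrite ?third_block // !inE eqxx ?orbT.
exists [set g' x; g' y; g' (third B x y)]; last by rewrite imset3 !gK' Eb.
rewrite inE; apply/existsP; exists (g' x); apply/existsP; exists (g' y).
apply/existsP; exists (g' (third B x y)).
rewrite (can_eq gK') yx eqxx andbT /=; apply/eqP/h_inj.
by rewrite hD !gK /= (negPf yx).
Qed.

End Projective.

Theorem theorem6p1 (v : nat) (B : {set {set 'I_v}}) (hB : steiner_system 2 3 B) :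
  projective B <-> #|` s_values B|%fset = 1.
Proof.
have orbP (pi : 'S_v) : [set pi @: b | b : {set 'I_v} in B] \in design_orbit B.
  exact: imset_f.
pose val_at (B' : {set {set 'I_v}}) := num_a 0 B' + num_a 3 B'.
split=> [/(pasch_of_projective hB) hP | /eqP/cardfs1P[c Ec]].
  apply/eqP/cardfs1P; exists (val_at [set (1%g : 'S_v) @: b | b : {set 'I_v} in B]).
  apply/fsetP => c; rewrite inE; apply/imfsetP/eqP => [[B' /= /imsetP[pi _ ->] ->] | ->].
    (* The order sign of any labelling is skew, so the form vanishes and all labellings give the
       same count. *)
    have bil0 (s : 'S_v) : third_form B (perm_sign s) (perm_sign s) = 0%R.
      apply: third_form_pasch => // x y xy; rewrite /perm_sign /sign_of.
      have : s x != s y by rewrite (inj_eq perm_inj).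
      by rewrite -val_eqE; case: ltngtP.
    have := num_a_perm pi hB; have := num_a_perm 1%g hB.
    rewrite /= (bil0 pi) (bil0 1%g) => <- /eqP.
    by rewrite eqz_nat eqn_pmul2r // => /eqP.
  by exists [set (1%g : 'S_v) @: b | b : {set 'I_v} in B]; first exact: orbP.
apply: (projective_of_pasch hB); apply: (pasch_of_const hB) => pi.
(* Every relabelling takes the single value [c], so the form is constant over labellings. *)
have Hc (s : 'S_v) : val_at [set s @: b | b : {set 'I_v} in B] = c.
  by apply/fset1P; rewrite -Ec; apply/imfsetP;
    exists [set s @: b | b : {set 'I_v} in B]; first exact: orbP.
have := num_a_perm pi hB; have := num_a_perm 1%g hB.
rewrite -!/(val_at _) !Hc => /= -> /addrI; lia.
Qed.
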